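(* In the symmetric Tardos scheme, the arcsine distribution is asymptotically optimal: for each integer $c \ge 1$ let $F_{2c}$ be the optimal (Gauss–Legendre) bias distribution function against $2c$ colluders, namely $F_{2c}(p) = \frac{1}{N_c}\sum_{k=1}^c w_{k,c} H(p - p_{k,c})$ for $0 \le p \le 1$; then for every $p \in (0,1)$, $F_{2c}(p) \to F_\infty(p) = \frac{2}{\pi}\arcsin\sqrt{p}$ as $c \to \infty$.
   Context: Symmetric Tardos scheme: for $n$ users and $\ell$ segments, biases $p_i \sim F$ are drawn independently for each segment $i$, code entries $X_{j,i} \sim \mathrm{Bernoulli}(p_i)$; given a pirate output $y \in \{0,1\}^\ell$, user $j$ gets score $\sum_i g(X_{j,i},y_i,p_i)$ with $g = +\sqrt{(1-p)/p}$ if $X=1,y=1$; $-\sqrt{(1-p)/p}$ if $X=1,y=0$; $-\sqrt{p/(1-p)}$ if $X=0,y=1$; $+\sqrt{p/(1-p)}$ if $X=0,y=0$; and is accused if the score exceeds a threshold. Here $P_c(x)=\frac{1}{2^c c!}\left(\frac{d}{dx}\right)^c(x^2-1)^c$ is the $c$th Legendre polynomial with roots $x_{1,c}<\cdots<x_{c,c}$ in $(-1,1)$, $p_{k,c}=(x_{k,c}+1)/2$, $w_{k,c}=2/\big((1-x_{k,c}^2)^{3/2}P_c'(x_{k,c})^2\big)$, $N_c=\sum_{k=1}^c w_{k,c}$, and $H$ is the Heaviside step function. The distributions $F_{2c}$ (equal to $F_{2c-1}$) are, by a result of Nuida et al., the bias distributions maximizing the expected coalition score against $2c-1$ or $2c$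 colluders; ''asymptotically optimal'' means that these optimal distributions converge to the arcsine distribution $F_\infty$. *)

(* Defs.v *)
From HB Require Import structures.
From mathcomp Require Import all_boot all_order all_algebra.
From mathcomp Require Import all_classical all_reals all_analysis.
From mathcomp Require Import polyrcf.
Set Implicit Arguments. Unset Strict Implicit. Unset Printing Implicit Defensive.
Import Order.TTheory GRing.Theory Num.Theory.
Local Open Scope ring_scope.

Section Tardos.
Variable R : realType.

(* c-th Legendre polynomial (Rodrigues formula):
   P_c = 1/(2^c c!) (d/dx)^c (x^2-1)^c *)
Definition legendreP (c : nat) : {poly R} :=
  ((2 ^+ c * (c`!)%:R)^-1) *: ((('X ^+ 2 - 1) ^+ c)^`(c)).

Definition legendre_roots (c : nat) : seq R := rootsR (legendreP c).

Definition bias_point (x : R) : R := (x + 1) / 2.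

Definition legendre_weight (c : nat) (x : R) : R :=
  2 / (powR (1 - x ^+ 2) (3 / 2) * ((legendreP c)^`()).[x] ^+ 2).

Definition legendre_N (c : nat) : R :=
  \sum_(x <- legendre_roots c) legendre_weight c x.

Definition heaviside (x : R) : R := if 0 <= x then 1 else 0.

Definition F2c (c : nat) (p : R) : R :=
  (legendre_N c)^-1 *
  \sum_(x <- legendre_roots c) legendre_weight c x * heaviside (p - bias_point x).

Definition F_infty (p : R) : R := 2 / pi * asin (Num.sqrt p).

End Tardos.

(* Main.v *)
Require Import Defs.
From HB Require Import structures.
From mathcomp Require Import all_boot all_order all_algebra.
From mathcomp Require Import all_classical all_reals all_analysis.
From mathcomp Require Import polyrcf ring lra.
Set Implicit Arguments.
Unset Strict Implicit.
Unset Printing Implicit Defensive.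
Import Order.TTheory GRing.Theory Num.Theory.
Import numFieldNormedType.Exports.
Local Open Scope classical_set_scope.
Local Open Scope ring_scope.

(** The weight of a root [x] of [P_c] is [lam x / sqrt (1 - x ^ 2)], where [lam x]
    is the Gauss-Legendre weight.  So [N_c] and its partial sums are Gauss
    quadratures of the function [f x = 1 / sqrt (1 - x ^ 2)] and of its truncations.

    Upper bound: [f] is an increasing limit of polynomials in [x ^ 2] with
    nonnegative coefficients, which Gauss quadrature underestimates; hence
    [N_c <= pi].

    Lower bound: for [s = sin th], truncating [f] to [x < s] and approximating it
    from below by a polynomial, on which the quadrature is exact for large [c],
    the sum of the weights of the roots [x <= s] is eventually at least
    [th + pi / 2 - e].  By the symmetry [x |-> - x], the remaining weights
    eventually sum to at least [- th + pi / 2 - e].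

    The two lower bounds add up to [pi - 2 e], so together with the upper bound
    they force the ratio to converge to [(th + pi / 2) / pi], which is [F_infty p]
    when [sin th = 2 p - 1]. *)

(** * Formal integration of polynomials over [-1, 1] *)

Section PolynomialIntegral.
Variable R : realType.
Implicit Types p q : {poly R}.

(* The constant term is [p`_0 / 0 = 0]. *)
Definition primitive p : {poly R} :=
  \poly_(i < (size p).+1) (p`_i.-1 / i%:R).

Lemma coef_primitive p i : (primitive p)`_i = p`_i.-1 / i%:R.
Proof.
rewrite coef_poly; case: ltnP => //; case: i => [|i] //= hi.
by rewrite nth_default ?mul0r.
Qed.

Lemma primitive_is_linear : linear primitive.
Proof.
move=> a p q; apply/polyP => i.
by rewrite coefD coefZ !coef_primitive coefD coefZ mulrDl mulrA.
Qed.

HB.instance Definition _ :=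
  GRing.isLinear.Build R {poly R} {poly R} _ primitive primitive_is_linear.

Lemma deriv_primitive p : (primitive p)^`() = p.
Proof.
apply/polyP => i; rewrite coef_deriv coef_primitive /=.
by rewrite -[LHS]mulr_natr divfK// pnatr_eq0.
Qed.

Lemma primitive_deriv p : primitive p^`() = p - (p`_0)%:P.
Proof.
apply/polyP => -[|i]; rewrite coef_primitive coefB coefC/= ?invr0 ?mulr0 ?subrr//.
by rewrite coef_deriv -[_ *+ i.+1]mulr_natr mulfK ?subr0// pnatr_eq0.
Qed.

(* The integral over [-1, 1]. *)
Definition poly_integral p : R := (primitive p).[1] - (primitive p).[-1].

Lemma poly_integral_is_scalar : scalar poly_integral.
Proof.
by move=> a p q; rewrite /poly_integral linearP/= !hornerD !hornerZ; ring.
Qed.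

HB.instance Definition _ :=
  GRing.isLinear.Build R {poly R} R _ poly_integral poly_integral_is_scalar.

Lemma poly_integral_deriv p : poly_integral p^`() = p.[1] - p.[-1].
Proof. by rewrite /poly_integral primitive_deriv !hornerD !hornerN !hornerC; ring. Qed.

Lemma poly_integral_reflect p : poly_integral (p \Po - 'X) = poly_integral p.
Proof.
have -> : p \Po - 'X = (- (primitive p \Po - 'X))^`().
  by rewrite derivN deriv_comp deriv_primitive derivN derivX mulrN1 opprK.
rewrite poly_integral_deriv !hornerN !horner_comp !hornerN !hornerX.
by rewrite /poly_integral !opprK; ring.
Qed.

(* The substitution [x = sin t] turns the integral of [p] into that of
   [p (sin t) * cos t]. *)
Lemma primitive_sin_ge p (k a b : R) : a <= b ->
  (forall t, a < t < b -> k <= p.[sin t] * cos t) ->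
  k * (b - a) <= (primitive p).[sin b] - (primitive p).[sin a].
Proof.
rewrite le_eqVlt => /predU1P[-> _|ab h]; first by rewrite !subrr mulr0.
have D (t : R) : is_derive t (1 : R) (horner (primitive p) \o sin) (p.[sin t] * cos t).
  have := is_derive1_comp (is_derive_poly (primitive p) (sin t)) (is_derive_sin t).
  by rewrite deriv_primitive.
have [|c cab] := MVT ab (fun t _ => D t).
  apply: derivable_within_continuous => t _.
  by have [] := D t.
rewrite /= => ->; rewrite ler_wpM2r ?subr_ge0 ?(ltW ab)//.
by apply: h; move: cab; rewrite in_itv.
Qed.

Lemma poly_integral_ge0 p : (forall x, -1 < x < 1 -> 0 <= p.[x]) ->
  0 <= poly_integral p.
Proof.
move=> h; have := @primitive_sin_ge p 0 (- (pi / 2)) (pi / 2).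
rewrite mul0r sinN sin_pihalf /poly_integral; apply.
  by have := pi_gt0 R; lra.
move=> t tI; apply: mulr_ge0; last by apply/ltW/cos_gt0_pihalf.
have ct := cos_gt0_pihalf tI; have := cos2Dsin2 t.
by move=> cs; apply: h; nra.
Qed.

(** Under [x = sin t] the integrand becomes [p.[sin t] * cos t <= 1] on an interval of length [pi];
    applying the lower bound to [- p] turns it into an upper bound. *)
Lemma poly_integral_le_pi p :
  (forall x, -1 < x < 1 -> p.[x] * Num.sqrt (1 - x ^+ 2) <= 1) ->
  poly_integral p <= pi.
Proof.
move=> h; have := @primitive_sin_ge (- p) (-1) (- (pi / 2)) (pi / 2).
have -> : primitive (- p) = - primitive p by rewrite linearN.
rewrite !hornerN sinN sin_pihalf /poly_integral.
have pi0 := pi_gt0 R.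
move=> H; suff : -1 * (pi / 2 - - (pi / 2)) <=
  - (primitive p).[1] - - (primitive p).[-1] by lra.
apply: H => [|t tI]; first lra.
have ct := cos_gt0_pihalf tI; have cs := cos2Dsin2 t.
rewrite hornerN mulNr lerN2.
have := h (sin t); have -> : 1 - sin t ^+ 2 = cos t ^+ 2 by rewrite -cs addrK.
by rewrite sqrtr_sqr gtr0_norm//; apply; nra.
Qed.

End PolynomialIntegral.

(** * Legendre polynomials: endpoint values, roots, orthogonality and parity *)

Section Legendre.
Variable R : realType.
Implicit Types p q : {poly R}.

(** Each differentiation uses up one factor ['X - a], and at [a] only the term that differentiates
    the power survives, which builds up the falling factorial. The case [j < n] gives zeros at [a],
    the case [j = n] the value there. *)
Lemma derivn_exp_factor (a : R) q n j : (j <= n)%N ->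
  exists2 r : {poly R}, (('X - a%:P) ^+ n * q)^`(j) = ('X - a%:P) ^+ (n - j) * r
    & r.[a] = (n ^_ j)%:R * q.[a].
Proof.
elim: j => [|j IH] jn; first by exists q; rewrite ?subn0 ?ffactn0 ?mul1r.
have [r e ra] := IH (ltnW jn).
exists (r *+ (n - j) + ('X - a%:P) * r^`()).
  rewrite derivnS e derivM deriv_exp derivB derivX derivC subr0 mul1r.
  rewrite -(subnSK jn) /=; set m := (n - j.+1)%N.
  by rewrite exprS -mulr_natr -(mulr_natr r); ring.
rewrite ffactnSr natrM hornerD hornerM hornerMn !hornerE ra -mulr_natr; ring.
Qed.

(** Rolle's theorem between consecutive roots. The bound by [last x s] later keeps the new roots
    below 1. *)
Lemma rolle_path p (x : R) s : path <%R x s -> all (root p) (x :: s) ->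
  exists s', [/\ size s' = size s, path <%R x s', all (root p^`()) s'
    & all (fun z => z < last x s) s'].
Proof.
elim: s x => [|y s IH] x /=; first by exists [::].
move=> /andP[xy ys] /and3P[px py ps].
have [|s' [size_s' path_s' root_s' last_s']] := IH y ys; first by rewrite /= py.
have [z] := poly_rolle xy (eq_trans (rootP px) (esym (rootP py))).
rewrite in_itv /= => /andP[xz zy] pz.
exists (z :: s'); split => /=; first by rewrite size_s'.
- by rewrite xz; case: s' path_s' {size_s' root_s' last_s'} => //= w s' /andP[yw ->];
    rewrite (lt_trans zy yw).
- by rewrite root_s' andbT; apply/rootP.
- rewrite last_s' andbT (lt_le_trans zy)//.
  by have := mem_last y s; rewrite inE => /predU1P[->//|];
    move/(allP (lt_path_min ys))/ltW.
Qed.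

Definition rodrigues c : {poly R} := ('X ^+ 2 - 1) ^+ c.

Lemma legendrePE c : legendreP R c = (2 ^+ c * (c`!)%:R)^-1 *: (rodrigues c)^`(c).
Proof. by []. Qed.

Lemma legendre_scale_neq0 c : 2 ^+ c * (c`!)%:R != 0 :> R.
Proof. by rewrite mulf_neq0 ?expf_neq0 ?pnatr_eq0// -lt0n fact_gt0. Qed.

Lemma rodriguesE1 c : rodrigues c = ('X - 1%:P) ^+ c * ('X + 1) ^+ c.
Proof. by rewrite /rodrigues -exprMn; congr (_ ^+ _); ring. Qed.

Lemma rodriguesEN1 c : rodrigues c = ('X - (-1)%:P) ^+ c * ('X - 1) ^+ c.
Proof. by rewrite /rodrigues -exprMn; congr (_ ^+ _); rewrite polyCN polyC1; ring. Qed.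

Lemma derivn_rodrigues_at1 c j : (j < c)%N -> (rodrigues c)^`(j).[1] = 0.
Proof.
move=> jc; rewrite rodriguesE1.
have [r -> _] := derivn_exp_factor 1 (('X + 1) ^+ c) (ltnW jc).
by rewrite !hornerE subrr expr0n subn_eq0 leqNgt jc mul0r.
Qed.

Lemma derivn_rodrigues_atN1 c j : (j < c)%N -> (rodrigues c)^`(j).[-1] = 0.
Proof.
move=> jc; rewrite rodriguesEN1.
have [r -> _] := derivn_exp_factor (-1) (('X - 1) ^+ c) (ltnW jc).
by rewrite !hornerE subrr expr0n subn_eq0 leqNgt jc mul0r.
Qed.

Lemma legendreP_at1 c : (legendreP R c).[1] = 1.
Proof.
rewrite legendrePE hornerZ rodriguesE1.
have [r -> h] := derivn_exp_factor 1 (('X + 1) ^+ c) (leqnn c).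
rewrite subnn expr0 mul1r h ffactnn (_ : horner _ _ = 2 ^+ c).
  by rewrite mulrC [_%:R * _]mulrC mulfV// legendre_scale_neq0.
by rewrite horner_exp !hornerE.
Qed.

Lemma legendreP_atN1 c : (legendreP R c).[-1] = (-1) ^+ c.
Proof.
rewrite legendrePE hornerZ rodriguesEN1.
have [r -> h] := derivn_exp_factor (-1) (('X - 1) ^+ c) (leqnn c).
rewrite subnn expr0 mul1r h ffactnn (_ : horner _ _ = (-1) ^+ c * 2 ^+ c).
  by rewrite [(c`!)%:R * _]mulrC -mulrA mulrCA mulVf ?mulr1// legendre_scale_neq0.
by rewrite horner_exp !hornerE -exprMn; congr (_ ^+ _); ring.
Qed.

Lemma legendreP_neq0 c : legendreP R c != 0.
Proof.
by apply: contra_eq_neq (legendreP_at1 c) => ->; rewrite horner0 eq_sym oner_neq0.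
Qed.

Lemma size_derivn_le p n : (size p^`(n) <= size p - n)%N.
Proof.
elim: n => [|n IH]; first by rewrite subn0.
rewrite derivnS subnS -ltnS; case: (eqVneq p^`(n) 0) => [->|p0].
  by rewrite deriv0 size_poly0.
exact: leq_trans (lt_size_deriv p0) (leq_trans IH (leqSpred _)).
Qed.

Lemma size_legendreP_le c : (size (legendreP R c) <= c.+1)%N.
Proof.
rewrite (leq_trans (size_scale_leq _ _))//.
rewrite (leq_trans (size_derivn_le _ _))// leq_subLR.
rewrite (leq_trans (size_poly_exp_leq _ _))// -polyC1 size_XnsubC//.
by rewrite addnS ltnS mul2n addnn.
Qed.

(** For [j < c] the endpoints -1 and 1 are still roots of the [j]-th derivative; together with its
    [j] interior roots they leave [j + 1] gaps for Rolle's theorem. *)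
Lemma derivn_rodrigues_roots c j : (j <= c)%N ->
  exists s, [/\ size s = j, path <%R (-1) s, all (fun z => z < 1) s
    & all (root (rodrigues c)^`(j)) s].
Proof.
elim: j => [|j IH] jc; first by exists [::].
have [s [size_s path_s lt1_s root_s]] := IH (ltnW jc).
have [||s'] := @rolle_path (rodrigues c)^`(j) (-1) (rcons s 1).
- rewrite rcons_path path_s /=.
  have := mem_last (-1) s; rewrite inE => /predU1P[->|/(allP lt1_s)//].
  lra.
- rewrite /= all_rcons root_s /root derivn_rodrigues_at1// derivn_rodrigues_atN1//.
  by rewrite eqxx.
- rewrite size_rcons size_s last_rcons -derivnS => -[? ? ? ?].
  by exists s'.
Qed.

Lemma rootsR_uniq_mem p : p != 0 ->
  uniq (rootsR p) /\ (forall x, (x \in rootsR p) = root p x).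
Proof.
move=> p0; split; first exact: uniq_roots.
by move=> x; have := roots_on_rootsR p0 x; rewrite in_itv/= => <-.
Qed.

(** Rolle's theorem yields [c] roots inside the interval, and the degree bound leaves room for no
    others. *)
Lemma legendre_rootsP c : [/\ uniq (legendre_roots R c),
   size (legendre_roots R c) = c,
   (forall x, (x \in legendre_roots R c) = root (legendreP R c) x) &
   (forall x, x \in legendre_roots R c -> -1 < x < 1)].
Proof.
have [uR mR] := rootsR_uniq_mem (legendreP_neq0 c).
have [s [size_s path_s lt1_s root_s]] := derivn_rodrigues_roots (leqnn c).
have us : uniq s by apply: lt_sorted_uniq; exact: path_sorted path_s.
have sub : {subset s <= legendre_roots R c}.
  move=> x xs; rewrite mR /root legendrePE hornerZ (rootP (allP root_s x xs)).
  by rewrite mulr0.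
have [|es ms] := uniq_min_size us sub.
  rewrite size_s -ltnS (leq_trans _ (size_legendreP_le c))//.
  apply: max_poly_roots => //; first exact: legendreP_neq0.
  by apply/allP => x; rewrite mR.
split => //; first by rewrite -es.
move=> x; rewrite -ms => xs.
by rewrite (allP lt1_s x xs) andbT (allP (lt_path_min path_s)).
Qed.

Lemma size_legendreP c : size (legendreP R c) = c.+1.
Proof.
apply/eqP; rewrite eqn_leq size_legendreP_le /=.
have [uR sR mR _] := legendre_rootsP c.
rewrite -{1}sR; apply: max_poly_roots => //; first exact: legendreP_neq0.
by apply/allP => x; rewrite mR.
Qed.

Lemma legendreP_factor c : legendreP R c =
  lead_coef (legendreP R c) *: \prod_(x <- legendre_roots R c) ('X - x%:P).
Proof.
have [uR sR mR _] := legendre_rootsP c.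
apply: all_roots_prod_XsubC; first by rewrite size_legendreP sR.
  by apply/allP => x; rewrite mR.
by rewrite uniq_rootsE.
Qed.

(** Repeated integration by parts: the boundary terms vanish because derivatives of [rodrigues c] of
    order below [c] are zero at -1 and 1, and each step lowers the degree of the other factor until
    it is 0. *)
Lemma legendreP_orthogonal c q : (size q <= c)%N ->
  poly_integral (legendreP R c * q) = 0.
Proof.
move=> sq; rewrite legendrePE -scalerAl linearZ /=.
suff -> : poly_integral ((rodrigues c)^`(c) * q) = 0 by rewrite mulr0.
suff H j (r : {poly R}) : (j <= c)%N -> (size r <= j)%N ->
  poly_integral ((rodrigues c)^`(j) * r) = 0 by exact: H.
elim: j r => [|j IH] r jc sr.
  by move: sr; rewrite leqn0 size_poly_eq0 => /eqP->; rewrite mulr0 linear0.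
have -> : (rodrigues c)^`(j.+1) * r =
    ((rodrigues c)^`(j) * r)^`() - (rodrigues c)^`(j) * r^`().
  by rewrite derivM -derivnS addrK.
rewrite linearB /= poly_integral_deriv !hornerM derivn_rodrigues_at1//.
rewrite derivn_rodrigues_atN1// IH ?mul0r ?subr0//; first exact: ltnW.
rewrite -ltnS; case: (eqVneq r 0) => [->|r0]; first by rewrite deriv0 size_poly0.
exact: leq_trans (lt_size_deriv r0) sr.
Qed.

Lemma derivn_comp_opp p n : (p \Po - 'X)^`(n) = (-1) ^+ n *: (p^`(n) \Po - 'X).
Proof.
elim: n => [|n IH]; first by rewrite scale1r.
rewrite derivnS IH derivZ deriv_comp derivN derivX mulrN1 -derivnS scalerN.
by rewrite exprS mulN1r scaleNr.
Qed.

(** [rodrigues c] is even, and each of the [c] derivatives contributes a sign. *)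
Lemma legendreP_reflect c : legendreP R c \Po - 'X = (-1) ^+ c *: legendreP R c.
Proof.
rewrite legendrePE comp_polyZ [RHS]scalerA [(-1) ^+ c * _]mulrC -[RHS]scalerA.
congr (_ *: _).
have even : rodrigues c \Po - 'X = rodrigues c.
  by rewrite /rodrigues rmorphXn /= comp_polyB rmorphXn /= comp_polyX sqrrN comp_polyC.
rewrite -[LHS]scale1r -[X in X *: _ = _](sqrr_sign R c) expr2 -scalerA.
by rewrite -derivn_comp_opp even.
Qed.

End Legendre.

(** * Gauss-Legendre quadrature and its exactness *)

Section GaussQuadrature.
Variables (R : realType) (c : nat).
Implicit Types p q l : {poly R}.

Local Notation P := (legendreP R c).

Definition gauss_weight (x : R) : R :=
  2 / ((1 - x ^+ 2) * (P^`()).[x] ^+ 2).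

Definition gauss_sum p : R :=
  \sum_(x <- legendre_roots R c) gauss_weight x * p.[x].

Lemma gauss_sum_is_scalar : scalar gauss_sum.
Proof.
move=> a p q; rewrite /gauss_sum mulr_sumr -big_split; apply: eq_bigr => x _ /=.
by rewrite hornerD hornerZ; ring.
Qed.

HB.instance Definition _ :=
  GRing.isLinear.Build R {poly R} R _ gauss_sum gauss_sum_is_scalar.

Lemma gauss_weight_ge0 x : -1 < x < 1 -> 0 <= gauss_weight x.
Proof.
by move=> xI; rewrite /gauss_weight divr_ge0// mulr_ge0 ?sqr_ge0//; nra.
Qed.

Definition cofactor x : {poly R} := P %/ ('X - x%:P).

Lemma cofactorE x : root P x -> P = cofactor x * ('X - x%:P).
Proof. by rewrite root_factor_theorem => /divpK. Qed.

Lemma size_cofactor x : size (cofactor x) = c.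
Proof. by rewrite size_divp ?polyXsubC_eq0// size_XsubC size_legendreP subn1. Qed.

Lemma deriv_legendreP_root x : root P x -> (P^`()).[x] = (cofactor x).[x].
Proof.
move=> /cofactorE {1}->.
by rewrite derivM derivB derivX derivC subr0 mulr1 hornerD hornerM !hornerE subrr
  mulr0 add0r.
Qed.

Lemma size_deriv_le p n : (size p <= n)%N -> (size p^`() <= n)%N.
Proof.
case: (eqVneq p 0) => [->|p0]; first by rewrite deriv0 size_poly0.
by move=> pn; apply: leq_trans (ltnW (lt_size_deriv p0)) pn.
Qed.

(* Integrate the derivative of [('X - x) * cofactor ^ 2], which is
   [cofactor ^ 2 + 2 P * cofactor'] by [P = ('X - x) * cofactor]. *)
Lemma poly_integral_cofactor_sqr x : root P x -> -1 < x < 1 ->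
  poly_integral (cofactor x ^+ 2) = 2 / (1 - x ^+ 2).
Proof.
move=> Px xI; set l := cofactor x.
have eP : P = l * ('X - x%:P) := cofactorE Px.
have -> : l ^+ 2 = (('X - x%:P) * l ^+ 2)^`() - (P * l^`() + P * l^`()).
  by rewrite derivM deriv_exp derivB derivX derivC eP; ring.
rewrite [LHS]linearB /= [poly_integral (_ + _)]linearD /=.
rewrite legendreP_orthogonal ?addr0 ?subr0; last first.
  by rewrite size_deriv_le// size_cofactor.
rewrite poly_integral_deriv ![(_ * l ^+ 2).[_]]hornerM !hornerXsubC !horner_exp.
have e1 : l.[1] * (1 - x) = 1.
  by rewrite -[RHS](legendreP_at1 R c) eP hornerM hornerXsubC.
have eN1 : (l.[-1] * (-1 - x)) ^+ 2 = 1.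
  rewrite -[RHS](sqrr_sign R c) -(legendreP_atN1 R c) eP hornerM hornerXsubC.
  by [].
have x1 : 1 - x != 0 by lra.
have xN1 : -1 - x != 0 by lra.
have -> : l.[1] = (1 - x)^-1 by apply: (mulIf x1); rewrite e1 mulVf.
have -> : l.[-1] ^+ 2 = ((-1 - x) ^+ 2)^-1.
  by apply: (mulIf (expf_neq0 2 xN1)); rewrite -exprMn eN1 mulVf// expf_neq0.
by field; rewrite x1 xN1 /=; nra.
Qed.

(** Writing [l - l.[x] = t * ('X - x)] gives [l ^ 2 = l.[x] * l + P * t], and [P * t] integrates to
    0 by orthogonality. *)
Lemma poly_integral_cofactor_sqrM x : root P x ->
  poly_integral (cofactor x ^+ 2) = (P^`()).[x] * poly_integral (cofactor x).
Proof.
move=> Px; rewrite deriv_legendreP_root//; set l := cofactor x.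
have eP : P = l * ('X - x%:P) := cofactorE Px.
have /factor_theorem[t et] : root (l - (l.[x])%:P) x.
  by rewrite /root hornerD hornerN hornerC subrr.
have st : (size t <= c)%N.
  case: (eqVneq t 0) => [->|t0]; first by rewrite size_poly0.
  have : (size (t * ('X - x%:P))%R <= maxn c 1)%N.
    rewrite -et (leq_trans (size_polyD _ _))// geq_max size_cofactor size_polyN.
    by rewrite leq_maxl leq_max size_polyC_leq1 orbT.
  rewrite size_Mmonic ?monicXsubC// size_XsubC addn2 /= leq_max.
  by case/orP => [/ltnW//|]; rewrite ltnS leqn0 size_poly_eq0 (negPf t0).
have -> : l ^+ 2 = l.[x] *: l + P * t.
  rewrite eP -[_ * t]mulrA [_ * t]mulrC -et -mul_polyC; ring.
by rewrite linearD linearZ /= legendreP_orthogonal// addr0.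
Qed.

(** Otherwise the second evaluation of the integral of [cofactor x ^+ 2] would be 0, while the first
    is nonzero. *)
Lemma deriv_legendreP_neq0 x : root P x -> -1 < x < 1 -> (P^`()).[x] != 0.
Proof.
move=> Px xI; apply: contra_eq_neq (poly_integral_cofactor_sqr Px xI) => P'x.
rewrite poly_integral_cofactor_sqrM// P'x mul0r eq_sym mulf_neq0 ?pnatr_eq0//.
by rewrite invr_eq0; nra.
Qed.

(** Equate the two evaluations of the integral of [cofactor x ^+ 2]. This identifies
    [gauss_weight x] as the integral of the Lagrange basis polynomial. *)
Lemma poly_integral_cofactor x : root P x -> -1 < x < 1 ->
  poly_integral (cofactor x) = gauss_weight x * (P^`()).[x].
Proof.
move=> Px xI; have P'x := deriv_legendreP_neq0 Px xI.
have := poly_integral_cofactor_sqr Px xI; rewrite poly_integral_cofactor_sqrM// => H.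
have x2 : 1 - x ^+ 2 != 0 by nra.
apply: (mulfI P'x); rewrite H /gauss_weight; field.
by rewrite P'x x2.
Qed.

Lemma gauss_sum_multiple q : gauss_sum (P * q) = 0.
Proof.
have [_ _ mR _] := legendre_rootsP R c.
rewrite /gauss_sum big_seq big1// => x; rewrite mR => /rootP Px.
by rewrite hornerM Px mul0r mulr0.
Qed.

(** Both sides have size at most [c] and agree at the [c] roots, since [cofactor y] vanishes at
    every root other than [y]. *)
Lemma lagrange_legendre p : (size p <= c)%N ->
  p = \sum_(x <- legendre_roots R c) (p.[x] / (P^`()).[x]) *: cofactor x.
Proof.
have [uR sR mR iR] := legendre_rootsP R c.
move=> sp; apply/eqP; rewrite -subr_eq0; apply/eqP.
apply: (@roots_geq_poly_eq0 _ _ (legendre_roots R c)) => //; last first.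
  rewrite sR (leq_trans (size_polyD _ _))// geq_max sp size_polyN.
  apply: (leq_trans (size_sum _ _ _)); apply/bigmax_leqP_seq => x _ _.
  by rewrite (leq_trans (size_scale_leq _ _))// size_cofactor.
apply/allP => x xR; rewrite /root hornerD hornerN horner_sum.
have Px : root P x by rewrite -mR.
rewrite (bigD1_seq x)//= hornerZ -deriv_legendreP_root// divfK; last first.
  by apply: deriv_legendreP_neq0 => //; exact: iR.
rewrite big_seq_cond big1 ?addr0 ?subrr// => y /andP[yR yx].
have : (cofactor y).[x] = 0; last by rewrite hornerZ => ->; rewrite mulr0.
have := rootP Px; rewrite (@cofactorE y) -?mR// hornerM hornerXsubC => /eqP.
by rewrite mulf_eq0 subr_eq0 (eq_sym x) (negPf yx) orbF => /eqP.
Qed.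

(** Divide by [P]: the multiple of [P] integrates to 0 by orthogonality and vanishes at the nodes,
    and the remainder equals its Lagrange interpolant. *)
Lemma gauss_exact p : (size p <= c + c)%N -> poly_integral p = gauss_sum p.
Proof.
have [uR sR mR iR] := legendre_rootsP R c.
move=> sp; rewrite (divp_eq p P) mulrC !linearD /=.
rewrite gauss_sum_multiple legendreP_orthogonal; last first.
  by rewrite size_divp ?legendreP_neq0// size_legendreP leq_subLR.
rewrite !add0r; set r := p %% P.
have sr : (size r <= c)%N.
  by rewrite -ltnS -(size_legendreP R c) ltn_modp legendreP_neq0.
rewrite {1}(lagrange_legendre sr) linear_sum /= /gauss_sum.
rewrite big_seq [RHS]big_seq; apply: eq_bigr => x xR.
have Px : root P x by rewrite -mR.
rewrite linearZ /= poly_integral_cofactor ?iR//.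
have := deriv_legendreP_neq0 Px (iR _ xR).
by move=> ?; field.
Qed.

End GaussQuadrature.

(** * Division of polynomials with nonnegative coefficients *)

Section NonnegativeCoefficients.
Variable R : numDomainType.
Implicit Types p q : {poly R}.

Definition nneg_coef p := forall i, 0 <= p`_i.

Lemma nneg_coefC a : 0 <= a -> nneg_coef a%:P.
Proof. by move=> a0 i; rewrite coefC; case: ifP. Qed.

Lemma nneg_coefX : nneg_coef 'X.
Proof. by move=> i; rewrite coefX ler0n. Qed.

Lemma nneg_coefD p q : nneg_coef p -> nneg_coef q -> nneg_coef (p + q).
Proof. by move=> p0 q0 i; rewrite coefD addr_ge0. Qed.

Lemma nneg_coefM p q : nneg_coef p -> nneg_coef q -> nneg_coef (p * q).
Proof. by move=> p0 q0 i; rewrite coefM sumr_ge0// => j _; rewrite mulr_ge0. Qed.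

Lemma nneg_coef_exp p n : nneg_coef p -> nneg_coef (p ^+ n).
Proof.
move=> p0; elim: n => [|n IH]; first by rewrite expr0; exact: nneg_coefC.
by rewrite exprS; exact: nneg_coefM.
Qed.

Lemma nneg_coef_horner_ge0 p x : nneg_coef p -> 0 <= x -> 0 <= p.[x].
Proof.
by move=> p0 x0; rewrite horner_coef sumr_ge0// => i _; rewrite mulr_ge0// exprn_ge0.
Qed.

(** Synthetic division at [a] only adds and multiplies nonnegative numbers. *)
Lemma nneg_coef_divXsubC p a : nneg_coef p -> 0 <= a ->
  exists2 q, nneg_coef q & p = q * ('X - a%:P) + (p.[a])%:P.
Proof.
move=> + a0; elim/poly_ind: p => [|p b IH] pP.
  by exists 0; [move=> i; rewrite coef0 | rewrite horner0 mul0r add0r].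
have p'P : nneg_coef p.
  by move=> i; have := pP i.+1; rewrite coefD coefMX coefC /= addr0.
have [q qP e] := IH p'P.
exists (q * 'X + (p.[a])%:P).
  apply: nneg_coefD; first by apply: nneg_coefM => //; exact: nneg_coefX.
  by apply: nneg_coefC; exact: nneg_coef_horner_ge0.
rewrite {1}e hornerD hornerM hornerX hornerC polyCD polyCM; ring.
Qed.

Lemma nneg_coef_div_prod p (s : seq R) : nneg_coef p ->
  (forall a, a \in s -> 0 <= a) ->
  exists q, exists2 r : {poly R}, nneg_coef q &
    (size r <= size s)%N /\ p = q * \prod_(a <- s) ('X - a%:P) + r.
Proof.
elim: s p => [|a s IH] p pP s0.
  by exists p, 0; rewrite ?size_poly0 ?big_nil ?mulr1 ?addr0.
have [q qP eb] := nneg_coef_divXsubC pP (s0 a (mem_head _ _)).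
have [|q' [r q'P [sr er]]] := IH _ qP.
  by move=> x xs; apply: s0; rewrite in_cons xs orbT.
exists q', (r * ('X - a%:P) + (p.[a])%:P) => //; split; last first.
  by rewrite big_cons {1}eb {1}er; ring.
rewrite (leq_trans (size_polyD _ _))// geq_max (leq_trans (size_polyC_leq1 _))// andbT.
case: (eqVneq r 0) => [->|r0]; first by rewrite mul0r size_poly0.
by rewrite size_Mmonic ?monicXsubC// size_XsubC addn2.
Qed.

End NonnegativeCoefficients.

(** * Quadrature underestimates even polynomials with nonnegative coefficients *)

Section Underestimation.
Variable R : realType.

(** By parity the product of the ['X - x] equals that of the ['X + x]; multiplying the two pairs the
    factors into ['X^2 - x ^ 2]. *)
Lemma legendreP_sqr c : let P := legendreP R c in
  P ^+ 2 = lead_coef P ^+ 2 *: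
    (\prod_(a <- [seq x ^+ 2 | x <- legendre_roots R c]) ('X - a%:P) \Po 'X^2).
Proof.
move=> P; set M := \prod_(x <- legendre_roots R c) ('X - x%:P).
have eP : P = lead_coef P *: M := legendreP_factor R c.
have [_ sR _ _] := legendre_rootsP R c.
have l0 : lead_coef P != 0 by rewrite lead_coef_eq0 legendreP_neq0.
have MN : M \Po - 'X = (-1) ^+ c *: M.
  have := legendreP_reflect R c; rewrite -/P eP comp_polyZ scalerA mulrC -scalerA.
  by move/(scalerI l0).
have reflect_prod s : (\prod_(x <- s) ('X - x%:P)) \Po - 'X =
    (-1) ^+ size s *: \prod_(x <- s) ('X + x%:P) :> {poly R}.
  elim: s => [|x s IH]; first by rewrite !big_nil scale1r comp_polyC.
  rewrite !big_cons comp_polyM IH comp_polyB comp_polyX comp_polyC /= exprS.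
  by rewrite -!mul_polyC polyCM polyCN polyC1; ring.
have eM : M = \prod_(x <- legendre_roots R c) ('X + x%:P).
  by apply: (@scalerI _ _ ((-1) ^+ c)); rewrite ?signr_eq0// -MN reflect_prod sR.
rewrite {1}eP exprZn; congr (_ *: _).
rewrite expr2 {2}eM -big_split /= rmorph_prod big_map; apply: eq_bigr => x _ /=.
by rewrite comp_polyB comp_polyX comp_polyC polyC_exp; ring.
Qed.

(* Divide [g] by the product of the ['X - x_k ^+ 2]: since its roots are
   nonnegative, so are the coefficients of the quotient, and the quadrature error
   is the integral of [P_c ^+ 2] times a nonnegative function. *)
Lemma gauss_sum_le_integral c (g : {poly R}) : nneg_coef g ->
  gauss_sum c (g \Po 'X^2) <= poly_integral (g \Po 'X^2).
Proof.
move=> gP; have [_ sR _ _] := legendre_rootsP R c.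
have [|q [r qP [sr ->]]] :=
    nneg_coef_div_prod (s := [seq x ^+ 2 | x <- legendre_roots R c]) gP.
  by move=> _ /mapP[x _ ->]; exact: sqr_ge0.
set E := \prod_(_ <- _) _; rewrite size_map sR in sr.
rewrite comp_polyD comp_polyM; set P := legendreP R c.
have l0 : lead_coef P != 0 by rewrite lead_coef_eq0 legendreP_neq0.
have eE : E \Po 'X^2 = (lead_coef P ^+ 2)^-1 *: P ^+ 2.
  by rewrite legendreP_sqr scalerA mulVf ?scale1r// expf_neq0.
rewrite {}eE; set k := (lead_coef P ^+ 2)^-1; set q2 := q \Po 'X^2.
have -> : q2 * (k *: P ^+ 2) = P * (k *: (P * q2)) by rewrite -!mul_polyC; ring.
rewrite [leLHS]linearD [leRHS]linearD /= gauss_sum_multiple add0r.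
(* The size of [r \Po 'X^2] is at most [c + c], so its quadrature is exact and only the multiple of
   [P ^+ 2] remains to be compared. *)
rewrite -gauss_exact ?lerDr.
  apply: poly_integral_ge0 => x _.
  have -> : (P * (k *: (P * q2))).[x] = k * P.[x] ^+ 2 * q2.[x].
    by rewrite !(hornerM, hornerZ); ring.
  apply: mulr_ge0; first by rewrite mulr_ge0 ?invr_ge0 ?exprn_even_ge0.
  by rewrite /q2 horner_comp nneg_coef_horner_ge0// hornerXn sqr_ge0.
case: (eqVneq r 0) => [->|r0]; first by rewrite comp_poly0 size_poly0.
rewrite (leq_trans (size_comp_poly_leq _ _))// size_polyXn /=.
move: sr; rewrite -size_poly_gt0 in r0; case: (size r) r0 => // m _ /= mc.
by rewrite muln2 -addnn -addSn leq_add// ltnW.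
Qed.

End Underestimation.

(** * Polynomial approximation of the inverse square root and of a step *)

Section InverseSquareRoot.
Variable R : realType.

Lemma exprn_small (z e : R) : 0 <= z < 1 -> 0 < e -> exists n, z ^+ n <= e.
Proof.
move=> /andP[z0 z1] e0; have zn : `|z| < 1 by rewrite ger0_norm.
have /cvgrPdist_le/(_ _ e0)[n _ /(_ n (leqnn n)) /=] := @cvg_expr R z zn.
by rewrite sub0r normrN ger0_norm ?exprn_ge0//; exists n.
Qed.

(* The iteration [h = (u + h ^ 2) / 2], whose fixed point is [1 - sqrt (1 - u)]. *)
Definition sqrt_iter m : {poly R} :=
  iter m (fun h => 2^-1 *: ('X + h ^+ 2)) 0.

Lemma sqrt_iter_nneg m : nneg_coef (sqrt_iter m).
Proof.
elim: m => [|m IH] /=; first by move=> i; rewrite coef0.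
rewrite -mul_polyC; apply: nneg_coefM; first by apply: nneg_coefC; rewrite invr_ge0.
by apply: nneg_coefD; [exact: nneg_coefX | exact: nneg_coef_exp].
Qed.

(** One iteration multiplies the error [1 - v - h] by [(1 - v + h) / 2], which is at most [1 - v]
    because [h <= 1 - v]. *)
Lemma sqrt_iter_bounds m (v : R) : 0 <= v <= 1 ->
  let h := (sqrt_iter m).[1 - v ^+ 2] in
  0 <= h /\ 0 <= 1 - v - h <= (1 - v) ^+ m.+1.
Proof.
move=> /andP[v0 v1]; elim: m => [|m IH] /=.
  by rewrite horner0 subr0 expr1 lexx; split => //; lra.
move: IH; rewrite /= hornerZ hornerD hornerX horner_exp.
set h := (sqrt_iter m).[_] => -[h0 /andP[dh0 dh]].
have hE : 1 - v - 2^-1 * (1 - v ^+ 2 + h ^+ 2) = (1 - v - h) * ((1 - v + h) / 2).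
  by field.
rewrite hE; split; first nra.
rewrite mulr_ge0 ?divr_ge0//=; last lra.
by rewrite exprSr ler_pM//; lra.
Qed.

(** Take a truncated geometric series [G] in [h], an approximation of [1 - v] from below. Then
    [v * G = 1 - h ^ n - (1 - v - h) * G], and both subtracted terms are nonnegative, and small when
    [k <= v]. *)
Lemma invsqrt_approx (k e : R) : 0 < k <= 1 -> 0 < e ->
  exists2 g : {poly R}, nneg_coef g &
    forall v, 0 <= v <= 1 -> [/\ 0 <= v * g.[1 - v ^+ 2],
      v * g.[1 - v ^+ 2] <= 1 & k <= v -> 1 - e <= v * g.[1 - v ^+ 2]].
Proof.
move=> /andP[k0 k1] e0; have zI : 0 <= 1 - k < 1 by lra.
have e20 : 0 < e / 2 by lra.
have [n zn] := exprn_small zI e20.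
(* The iteration error gets multiplied by [G <= n], so [m] is chosen after [n]; the successor keeps
   the tolerance positive at [n = 0]. *)
have e2n0 : 0 < e / 2 / n.+1%:R by rewrite divr_gt0.
have [m zm] := exprn_small zI e2n0.
exists (\sum_(i < n) sqrt_iter m ^+ i).
  move=> j; rewrite coef_sum sumr_ge0// => i _.
  by apply: nneg_coef_exp; exact: sqrt_iter_nneg.
move=> v vI; have [h0 /andP[dh0 dh]] := sqrt_iter_bounds m vI.
have [v0 v1] := andP vI.
rewrite horner_sum; set h := (sqrt_iter m).[_] in h0 dh0 dh *.
under eq_bigr do rewrite horner_exp -/h.
set G := \sum_(i < n) h ^+ i.
have G0 : 0 <= G by rewrite sumr_ge0// => i _; rewrite exprn_ge0.
have Gn : G <= n%:R.
  rewrite -[n in n%:R]card_ord -sumr_const ler_sum// => i _.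
  by rewrite exprn_ile1//; lra.
have hG : (1 - h) * G = 1 - h ^+ n by have := subrX1 h n; rewrite -/G; lra.
have hn0 : 0 <= h ^+ n by rewrite exprn_ge0.
split; [by rewrite mulr_ge0 | nra | move=> kv].
have hn : h ^+ n <= e / 2.
  by apply: le_trans zn; rewrite lerXn2r ?nnegrE//; lra.
have dh' : 1 - v - h <= e / 2 / n.+1%:R.
  apply: le_trans dh _; apply: le_trans zm.
  have zv : 1 - v <= 1 - k by lra.
  have vz : 0 <= 1 - v by lra.
  apply: (@le_trans _ _ ((1 - v) ^+ m)); last by rewrite lerXn2r ?nnegrE//; lra.
  by rewrite exprSr ler_piMr ?exprn_ge0//; lra.
have : (1 - v - h) * G <= e / 2.
  apply: (@le_trans _ _ (e / 2 / n.+1%:R * n%:R)); first by rewrite ler_pM.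
  by rewrite -mulrA ger_pMr// mulrC ler_pdivrMr// mul1r ler_nat.
nra.
Qed.

Lemma bernoulli_ineq (a : R) n : -1 <= a -> 1 + n%:R * a <= (1 + a) ^+ n.
Proof.
move=> a1; elim: n => [|n IH]; first by rewrite mul0r addr0 expr0.
rewrite exprSr -natr1.
have : (1 + n%:R * a) * (1 + a) <= (1 + a) ^+ n * (1 + a) by rewrite ler_wpM2r//; lra.
have : 0 <= n%:R * a ^+ 2 by rewrite mulr_ge0// sqr_ge0.
nra.
Qed.

(* With [y] affine in [x] and [y = 1 / 2] at the jump, [(1 - y ^ n) ^ (2 ^ n)] is
   within [(2 y) ^ n] of [1] on one side and below [(2 y) ^ - n] on the other. *)
Lemma step_approx (a b e : R) : -1 <= a -> a < b -> b <= 1 -> 0 < e ->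
  exists B : {poly R}, forall x, -1 < x < 1 ->
    [/\ 0 <= B.[x] <= 1, x <= a -> 1 - e <= B.[x] & b <= x -> B.[x] <= e].
Proof.
(* This [d] gives [2 y <= 1 - d <= (1 + d)^-1] for [x <= a] and [1 + d <= 2 y] for [b <= x]. *)
move=> a1 ab b1 e0; pose d := (b - a) / 4.
have rI : 0 <= (1 + d)^-1 < 1.
  by rewrite invr_ge0 invf_lt1 /d; lra.
have [n rn] := exprn_small rI e0.
pose y : {poly R} := (1 / 2)%:P + (1 / 4) *: ('X - ((a + b) / 2)%:P).
exists ((1 - y ^+ n) ^+ (2 ^ n)) => x xI.
rewrite horner_exp hornerD hornerN hornerC horner_exp.
have -> : y.[x] = 1 / 2 + 1 / 4 * (x - (a + b) / 2).
  by rewrite /y hornerD hornerC hornerZ hornerXsubC.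
set t := 1 / 2 + _; have t0 : 0 <= t by rewrite /t; lra.
have t1 : t <= 1 by rewrite /t; lra.
have tn0 : 0 <= t ^+ n by rewrite exprn_ge0.
have tn1 : t ^+ n <= 1 by rewrite exprn_ile1.
split; first by rewrite exprn_ge0 ?exprn_ile1//; lra.
- move=> xa; have := @bernoulli_ineq (- t ^+ n) (2 ^ n).
  rewrite natrX mulrN -exprMn.
  have : (2 * t) ^+ n <= (1 + d)^-1 ^+ n.
    rewrite lerXn2r ?nnegrE//; [lra|lra|].
    rewrite -[leRHS]mul1r ler_pdivlMr /t /d; nra.
  lra.
(* As [(1 - s) * (1 + s) <= 1], a power of [1 - s] is at most the inverse of that of [1 + s], which
   Bernoulli's inequality bounds below. *)
- move=> bx; have := @bernoulli_ineq (t ^+ n) (2 ^ n).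
  rewrite natrX -exprMn => H.
  have H1 : (1 - t ^+ n) ^+ (2 ^ n) * (1 + t ^+ n) ^+ (2 ^ n) <= 1.
    by rewrite -exprMn exprn_ile1//; nra.
  have H2 : (1 + d) ^+ n <= (2 * t) ^+ n.
    by rewrite lerXn2r ?nnegrE /t /d; lra.
  have H3 : 0 <= (1 - t ^+ n) ^+ (2 ^ n) by rewrite exprn_ge0//; lra.
  have H4 : 0 < (1 + d) ^+ n by rewrite exprn_gt0// /d; lra.
  apply: le_trans rn; rewrite exprVn -[leRHS]mul1r ler_pdivlMr//.
  nra.
Qed.

End InverseSquareRoot.

(** * Polynomial lower approximation of the truncated arcsine density *)

Section LowerApproximation.
Variable R : realType.

(** The minimum is at an endpoint: [sin] is increasing, so according to the sign of [sin t], its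
    square is at most that of [sin b] or of [sin a]. *)
Lemma cos_lower_bound (a b : R) : - (pi / 2) < a -> a < b -> b < pi / 2 ->
  exists2 k, 0 < k <= 1 & forall t, a <= t <= b -> k <= cos t.
Proof.
move=> a0 ab b0.
have ca : 0 < cos a by apply: cos_gt0_pihalf; rewrite a0 (lt_trans ab).
have cb : 0 < cos b by apply: cos_gt0_pihalf; rewrite b0 (lt_trans a0).
exists (Num.min (cos a) (cos b)).
  by rewrite lt_min ca cb ge_min cos_le1.
move=> t /andP[at_ tb]; rewrite leNgt lt_min; apply/negP => /andP[ta' tb'].
have ct : 0 < cos t by apply: cos_gt0_pihalf; lra.
have I x : - (pi / 2) < x -> x < pi / 2 -> x \in `[- (pi / 2), pi / 2].
  by move=> ? ?; rewrite in_itv /=; lra.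
have sa : sin a <= sin t.
  rewrite le_eqVlt; have := at_; rewrite le_eqVlt => /predU1P[->|]; first by rewrite eqxx.
  by move=> h; rewrite ltr_sin ?h ?orbT//; apply: I; lra.
have sb : sin t <= sin b.
  rewrite le_eqVlt; have := tb; rewrite le_eqVlt => /predU1P[->|]; first by rewrite eqxx.
  by move=> h; rewrite ltr_sin ?h ?orbT//; apply: I; lra.
have := cos2Dsin2 a; have := cos2Dsin2 b; have := cos2Dsin2 t.
case: (leP 0 (sin t)) => st; nra.
Qed.

(** Multiply the approximation of [1 / sqrt (1 - x ^ 2)] by a smoothed step lowered by [eta], which
    makes the product nonpositive beyond [sin th]. *)
Lemma arcsine_lower_approx (th e : R) : - (pi / 2) < th < pi / 2 -> 0 < e ->
  exists r : {poly R}, [/\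
    forall x, -1 < x < 1 -> r.[x] * Num.sqrt (1 - x ^+ 2) <= 1,
    forall x, -1 < x < 1 -> sin th <= x -> r.[x] <= 0 &
    th + pi / 2 - e <= poly_integral r].
Proof.
move=> /andP[th0 th1] e0; have pi0 := pi_gt0 R.
(* A margin [rho] at the left keeps [cos] away from 0, and one at the right leaves the step room to
   fall; together they cost at most [e / 2]. The minimum ensures [a < b]. *)
pose rho := Num.min e (th + pi / 2) / 4.
have rho0 : 0 < rho by rewrite divr_gt0// lt_min e0 /=; lra.
have rhoe : rho <= e / 4 by rewrite ler_pM2r// ge_min lexx.
have rhot : rho <= (th + pi / 2) / 4 by rewrite ler_pM2r// ge_min lexx orbT.
pose a := - (pi / 2) + rho; pose b := th - rho.
have a0 : - (pi / 2) < a by rewrite /a; lra.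
have ab : a < b by rewrite /a /b; lra.
have bth : b < th by rewrite /b; lra.
have b1 : b < pi / 2 by lra.
have [k kI kcos] := cos_lower_bound a0 ab b1.
(* The integrand loses at most [3 * eta] over a length of at most [pi], that is [e / 2] in total. *)
pose eta := Num.min (1 / 2) (e / (6 * pi)).
have eta0 : 0 < eta by rewrite lt_min divr_gt0//= divr_gt0// mulr_gt0.
have eta2 : eta <= 1 / 2 by rewrite ge_min lexx.
have etae : eta * pi <= e / 6.
  apply: (@le_trans _ _ (e / (6 * pi) * pi)).
    by rewrite ler_pM2r// ge_min lexx orbT.
  by rewrite invfM mulrA divfK// gt_eqF.
have sbth : sin b < sin th by rewrite ltr_sin// in_itv /=; lra.
have [B HB] := step_approx (sin_geN1 b) sbth (sin_le1 th) eta0.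
have [g gP Hg] := invsqrt_approx kI eta0.
exists ((g \Po 'X^2) * (B - eta%:P)).
have rE (x : R) : ((g \Po 'X^2) * (B - eta%:P)).[x] = g.[x ^+ 2] * (B.[x] - eta).
  by rewrite hornerM horner_comp hornerXn hornerD hornerN hornerC.
have sinI (t : R) : - (pi / 2) < t < pi / 2 ->
    [/\ -1 < sin t < 1, 0 <= cos t <= 1 & sin t ^+ 2 = 1 - cos t ^+ 2].
  move=> tI; have ct := cos_gt0_pihalf tI; have cs := cos2Dsin2 t.
  by split; [nra | rewrite ltW//= cos_le1 | lra].
split.
- move=> x xI; rewrite rE; have [/andP[B0 B1] _ _] := HB x xI.
  have x2 : 0 <= 1 - x ^+ 2 by nra.
  set v := Num.sqrt _; have v2 : v ^+ 2 = 1 - x ^+ 2 by rewrite sqr_sqrtr.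
  have v0 : 0 <= v by exact: sqrtr_ge0.
  have [|G0 G1 _] := Hg v; first by nra.
  have -> : x ^+ 2 = 1 - v ^+ 2 by lra.
  nra.
- move=> x xI xth; rewrite rE; have [_ _ /(_ xth) Be] := HB x xI.
  by rewrite mulr_ge0_le0 ?subr_le0// nneg_coef_horner_ge0// sqr_ge0.
set r := (g \Po 'X^2) * (B - eta%:P).
have outer (t : R) : - (pi / 2) < t < pi / 2 -> - eta <= r.[sin t] * cos t.
  move=> tI; have [xI vI e2] := sinI t tI; rewrite rE e2.
  by have [/andP[B0 _] _ _] := HB _ xI; have [G0 G1 _] := Hg _ vI; nra.
(* The two factors are at least [1 - eta] and [1 - 2 * eta]. *)
have inner (t : R) : a < t < b -> 1 - 3 * eta <= r.[sin t] * cos t.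
  move=> /andP[at_ tb].
  have tI : - (pi / 2) < t < pi / 2 by lra.
  have [xI vI e2] := sinI t tI; rewrite rE e2.
  have stb : sin t <= sin b by rewrite ltW// ltr_sin// in_itv /=; lra.
  have [_ /(_ stb) B1 _] := HB _ xI; have [_ _ G1] := Hg _ vI.
  have {}G1 := G1 (kcos t _); have : 1 - eta <= cos t * g.[1 - cos t ^+ 2].
    by apply: G1; rewrite !ltW.
  nra.
have I1 := @primitive_sin_ge R r (- eta) (- (pi / 2)) a.
have I2 := @primitive_sin_ge R r (1 - 3 * eta) a b.
have I3 := @primitive_sin_ge R r (- eta) b (pi / 2).
have -> : poly_integral r =
    (primitive r).[sin (pi / 2)] - (primitive r).[sin (- (pi / 2))].
  by rewrite sinN sin_pihalf.
have {}I1 := I1 (ltW a0) _; have {}I2 := I2 (ltW ab) inner; have {}I3 := I3 (ltW b1) _.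
have J1 : - eta * (a - - (pi / 2)) <=
    (primitive r).[sin a] - (primitive r).[sin (- (pi / 2))].
  by apply: I1 => t tI; apply: outer; lra.
have J3 : - eta * (pi / 2 - b) <=
    (primitive r).[sin (pi / 2)] - (primitive r).[sin b].
  by apply: I3 => t tI; apply: outer; lra.
have : (1 - 3 * eta) * (b - a) >= b - a - 3 * eta * (b - a) by lra.
have : b - a = th + pi / 2 - 2 * rho by rewrite /a /b; lra.
have : 3 * eta * (b - a) + eta * (a - - (pi / 2)) + eta * (pi / 2 - b) <= e / 2.
  have : 0 <= eta * (a - - (pi / 2)) by rewrite mulr_ge0//; lra.
  have : 0 <= eta * (pi / 2 - b) by rewrite mulr_ge0//; lra.
  lra.
lra.
Qed.

End LowerApproximation.

(** * Tardos weights against Gauss weights, and the bound [N_c <= pi] *)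

Section TardosWeights.
Variables (R : realType) (c : nat).
Local Notation roots := (legendre_roots R c).

Lemma legendre_weightE (x : R) : -1 < x < 1 ->
  legendre_weight c x = gauss_weight c x / Num.sqrt (1 - x ^+ 2).
Proof.
move=> xI; have x0 : 0 < 1 - x ^+ 2 by nra.
rewrite /legendre_weight /gauss_weight -mulrA -invfM; congr (2 / _).
rewrite mulrAC; congr (_ * _).
have -> : 3 / 2 = 1 + 2^-1 :> R by field.
rewrite powRD ?powRr1 ?powR12_sqrt ?(ltW x0)//.
by rewrite gt_eqF ?implybT.
Qed.

Lemma legendre_weight_ge0 (x : R) : -1 < x < 1 -> 0 <= legendre_weight c x.
Proof.
by move=> xI; rewrite legendre_weightE// divr_ge0 ?sqrtr_ge0// gauss_weight_ge0.
Qed.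

Lemma legendre_weight_sum_ge0 (S : pred R) :
  0 <= \sum_(x <- roots | S x) legendre_weight c x.
Proof.
have [_ _ _ iR] := legendre_rootsP R c.
by rewrite big_seq_cond sumr_ge0// => x /andP[/iR /legendre_weight_ge0].
Qed.

Lemma gauss_weightE (x : R) : -1 < x < 1 ->
  gauss_weight c x = legendre_weight c x * Num.sqrt (1 - x ^+ 2).
Proof.
move=> xI; rewrite legendre_weightE// divfK// gt_eqF// sqrtr_gt0; nra.
Qed.

Lemma gauss_sum_le_weight (S : pred R) (r : {poly R}) :
  (forall x, -1 < x < 1 -> r.[x] * Num.sqrt (1 - x ^+ 2) <= 1) ->
  (forall x, -1 < x < 1 -> ~~ S x -> r.[x] <= 0) ->
  gauss_sum c r <= \sum_(x <- roots | S x) legendre_weight c x.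
Proof.
move=> r1 r0; have [_ _ _ iR] := legendre_rootsP R c.
rewrite /gauss_sum [leRHS]big_mkcond big_seq [leRHS]big_seq; apply: ler_sum => x xR.
have xI := iR x xR; case: ifPn => Sx; last first.
  by rewrite mulr_ge0_le0 ?gauss_weight_ge0 ?r0.
rewrite gauss_weightE// -mulrA ler_piMr ?legendre_weight_ge0//.
by rewrite mulrC r1.
Qed.

(** Supplies, for the finitely many nodes of a fixed [c], the threshold [k] that [invsqrt_approx]
    asks for. *)
Lemma sqrt_lower_bound (s : seq R) : (forall x, x \in s -> -1 < x < 1) ->
  exists2 k, 0 < k <= 1 & forall x, x \in s -> k <= Num.sqrt (1 - x ^+ 2).
Proof.
elim: s => [|x s IH] sI; first by exists 1; rewrite ?ltr01 ?lexx.
have [|k /andP[k0 k1] ks] := IH; first by move=> y ys; apply: sI; rewrite in_cons ys orbT.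
have xI := sI x (mem_head _ _).
exists (Num.min k (Num.sqrt (1 - x ^+ 2))).
  by rewrite lt_min k0 sqrtr_gt0 ge_min k1 /= andbT; nra.
move=> y; rewrite in_cons => /predU1P[->|/ks yk]; first by rewrite ge_min lexx orbT.
by rewrite ge_min yk.
Qed.

Lemma legendre_N_le_pi : legendre_N R c <= pi.
Proof.
have [_ _ _ iR] := legendre_rootsP R c.
have [k kI ks] := sqrt_lower_bound iR.
have N0 : 0 <= legendre_N R c.
  exact: legendre_weight_sum_ge0.
apply/ler_addgt0Pr => e e0; set N := legendre_N R c in N0 *.
(* A relative error [e / (N + 1)] at each node costs at most [e] on the whole sum, also when
   [N = 0]. *)
have eN : 0 < e / (N + 1) by rewrite divr_gt0//; lra.
have [g gP Hg] := invsqrt_approx kI eN.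
have sI (x : R) : -1 < x < 1 -> let v := Num.sqrt (1 - x ^+ 2) in
    0 <= v <= 1 /\ 1 - v ^+ 2 = x ^+ 2.
  move=> xI v; have x2 : 0 <= 1 - x ^+ 2 by nra.
  have v2 : v ^+ 2 = 1 - x ^+ 2 by rewrite sqr_sqrtr.
  have v0 : 0 <= v by exact: sqrtr_ge0.
  by split; [nra | lra].
have H1 : gauss_sum c (g \Po 'X^2) <= pi.
  apply: le_trans (gauss_sum_le_integral c gP) _; apply: poly_integral_le_pi => x xI.
  rewrite horner_comp hornerXn; have [vI e2] := sI x xI.
  by have [_ + _] := Hg _ vI; rewrite e2 mulrC.
have H2 : (1 - e / (N + 1)) * N <= gauss_sum c (g \Po 'X^2).
  rewrite {2}/N /legendre_N mulr_sumr /gauss_sum big_seq [leRHS]big_seq.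
  apply: ler_sum => x xR; have xI := iR x xR; have [vI e2] := sI x xI.
  rewrite horner_comp hornerXn gauss_weightE// -mulrA mulrC.
  rewrite ler_wpM2l ?legendre_weight_ge0//.
  by have [_ _] := Hg _ vI; rewrite e2; apply; exact: ks.
have : e / (N + 1) * N <= e.
  by rewrite -mulrA ger_pMr// mulrC ler_pdivrMr ?mul1r; lra.
lra.
Qed.

End TardosWeights.

(** * Lower bounds on both partial sums, and the limit *)

Section Limit.
Variable R : realType.

Lemma F2cE c (p : R) : F2c c p = (legendre_N R c)^-1 *
  \sum_(x <- legendre_roots R c | x <= 2 * p - 1) legendre_weight c x.
Proof.
rewrite /F2c [in RHS]big_mkcond; congr (_ * _); apply: eq_bigr => x _.
rewrite /heaviside /bias_point.
have -> : (0 <= p - (x + 1) / 2) = (x <= 2 * p - 1).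
  by apply/idP/idP => ?; lra.
by case: ifP => _; rewrite ?mulr1 ?mulr0.
Qed.

Lemma weight_sum_lower (th e : R) : - (pi / 2) < th < pi / 2 -> 0 < e ->
  \forall c \near \oo,
    th + pi / 2 - e <=
      \sum_(x <- legendre_roots R c | x <= sin th) legendre_weight c x /\
    - th + pi / 2 - e <=
      \sum_(x <- legendre_roots R c | ~~ (x <= sin th)) legendre_weight c x.
Proof.
move=> thI e0; have thI' : - (pi / 2) < - th < pi / 2 by lra.
have [r1 [le1 neg1 int1]] := arcsine_lower_approx thI e0.
have [r2 [le2 neg2 int2]] := arcsine_lower_approx thI' e0.
(* Reflection carries the approximation built for [- th] to the roots above [sin th]. *)
pose r3 := r2 \Po - 'X.
near=> c.
have c1 : (size r1 <= c)%N by near: c; exact: nbhs_infty_ge.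
have c3 : (size r3 <= c)%N by near: c; exact: nbhs_infty_ge.
split.
  apply: le_trans int1 _; rewrite (@gauss_exact _ c) ?(leq_trans c1) ?leq_addr//.
  by apply: gauss_sum_le_weight => // x xI; rewrite -ltNge => /ltW; exact: neg1.
rewrite -poly_integral_reflect -/r3 in int2.
apply: le_trans int2 _; rewrite (@gauss_exact _ c) ?(leq_trans c3) ?leq_addr//.
have r3E x : r3.[x] = r2.[- x] by rewrite horner_comp hornerN hornerX.
apply: gauss_sum_le_weight => x xI; rewrite r3E.
  by rewrite -sqrrN le2//; lra.
by rewrite negbK => xs; apply: neg2; [lra | rewrite sinN lerN2].
Unshelve. all: end_near. Qed.

(** With [sin u = sqrt p], [sin (2 u - pi / 2) = - cos (2 u) = 2 * sin u ^ 2 - 1]. *)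
Lemma sin_double_asin_sqrt (p : R) : 0 < p < 1 ->
  let th := 2 * asin (Num.sqrt p) - pi / 2 in
  - (pi / 2) < th < pi / 2 /\ sin th = 2 * p - 1.
Proof.
move=> /andP[p0 p1] th.
have s0 : 0 < Num.sqrt p by rewrite sqrtr_gt0.
have s2 : Num.sqrt p ^+ 2 = p by rewrite sqr_sqrtr// ltW.
have s1 : Num.sqrt p < 1 by nra.
have sI : -1 <= Num.sqrt p <= 1 by lra.
have a1 : asin (Num.sqrt p) < pi / 2 by apply: asin_ltpi2; lra.
have a0 : 0 < asin (Num.sqrt p).
  rewrite ltNge; apply/negP => a0.
  have : sin (- asin (Num.sqrt p)) < 0 by rewrite sinN asinK// oppr_lt0.
  rewrite ltNge sin_ge0_pi// oppr_ge0 a0 /=.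
  by have := asin_geNpi2 sI; have := pi_gt0 R; lra.
split; first by rewrite /th; lra.
have := cos2Dsin2 (asin (Num.sqrt p)); have := asinK (x := Num.sqrt p).
rewrite in_itv /= sI => /(_ isT) sE.
by rewrite sinBpihalf mulr_natl mulr2n cosD -!expr2 sE s2; lra.
Qed.

End Limit.

Theorem theorem2 (R : realType) (p : R) :
  0 < p < 1 ->
  (fun c : nat => F2c c p) @ \oo --> F_infty p.
Proof.
move=> p01; have [thI sth] := sin_double_asin_sqrt p01.
set th := 2 * asin _ - _ in thI sth.
have pi0 := pi_gt0 R; have pin0 : pi != 0 :> R by rewrite gt_eqF.
have FE : F_infty p = (th + pi / 2) / pi by rewrite /F_infty /th subrK mulrAC.
apply/cvgrPdist_le => e e0.
(* The first bound becomes [e] after division by [pi]; the second forces [A + B >= pi / 2 > 0]. *)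
pose d := Num.min (e * pi) (pi / 4).
have d0 : 0 < d by rewrite lt_min mulr_gt0//=; lra.
have de : d <= e * pi by rewrite ge_min lexx.
have dpi : d <= pi / 4 by rewrite ge_min lexx orbT.
apply: filterS (weight_sum_lower thI d0) => c.
rewrite F2cE -sth; set A := \sum_(_ <- _ | _) _; set B := \sum_(_ <- _ | _) _ => -[hA hB].
have NE : legendre_N R c = A + B.
  by rewrite /legendre_N (bigID (fun x => x <= sin th)).
have N1 := legendre_N_le_pi R c; rewrite NE in N1 *.
have N0 : 0 < A + B by lra.
have A0 : 0 <= A by exact: legendre_weight_sum_ge0.
have B0 : 0 <= B by exact: legendre_weight_sum_ge0.
(* As [A + B <= pi], both normalized sums are at least their quotients by [pi]; they add up to 1, so
   the lower bound for [B] is an upper bound for [A]. *)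
have A1 : A / pi <= (A + B)^-1 * A.
  by rewrite mulrC ler_wpM2r// lef_pV2.
have B1 : B / pi <= (A + B)^-1 * B.
  by rewrite mulrC ler_wpM2r// lef_pV2.
have AB : (A + B)^-1 * A + (A + B)^-1 * B = 1 by rewrite -mulrDr mulVf// gt_eqF.
have hA' : (th + pi / 2) / pi - e <= A / pi.
  by rewrite ler_pdivlMr// mulrBl divfK ?gt_eqF//; lra.
have hB' : 1 - (th + pi / 2) / pi - e <= B / pi.
  by rewrite ler_pdivlMr// !mulrBl divfK ?gt_eqF//; lra.
by rewrite FE ler_norml; apply/andP; split; lra.
Qed.
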